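(* Let $L_{+}$ and $L_{-}$ be countable linear orders that are convex-biembeddable, i.e., there exist an order embedding $f_{+}: L_{+} \to L_{-}$ whose image is a convex subset of $L_{-}$ and an order embedding $f_{-}: L_{-} \to L_{+}$ whose image is a convex subset of $L_{+}$. Suppose there exist countable sets $S^0_{+}$ and $S^0_{-}$ of linear orders such that $L_{+} \cong \Xi(S^0_{+})$ and $L_{-} \cong \Xi(S^0_{-})$. Then $L_{+} \cong L_{-}$ (as linear orders).
   Context: A subset $A$ of a linear order $L$ is convex if for every $a \in L \setminus A$, either $a < b$ for all $b \in A$ or $b < a$ for all $b \in A$. An order embedding is a strictly monotone (order-preserving injective) map; $\cong$ denotes order isomorphism. Given a linear order $L$, a set $S$ and a map $\chi: L \to S$, $\chi$ is a dense coloring if for every $s \in S$ and every $x < x'$ in $L$ there is $y \in L$ with $x < y < x'$ and $\chi(y) = s$. Given a linear order $L$ and a map $\chi$ assigning to each $x \in L$ a linear order $\chi(x)$, the ordered sum $\sum_{x \in L} \chi(x)$ is the set $\bigsqcup_{x \in L} \{x\} \times \chi(x)$ ordered by $(x,y) < (x',y')$ iff $x < x'$, or $x = x'$ and $y < y'$. For a nonempty countable set $S$ of linear orders, the shuffle $\Xi(S)$ is the linear order $\sum_{q \in \mathbb{Q}} \chi(q)$ where $\chi: \mathbb{Q} \to S$ is a dense coloring of the rationals $(\mathbb{Q},<)$; such a dense coloring exists and is unique up to an automorphism of $\mathbb{Q}$, so $\Xi(S)$ is well defined up to isomorphism. (For $S = \emptyset$, $\Xi(S)$ is the empty order; equivalently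 one may always add the empty order to $S$ without changing $\Xi(S)$.) *)

(* Defs.v *)
(* Linear orders are MathComp [orderType]s (possibly empty, no countability
   built in); countability is [countable] from mathcomp-classical. *)
From mathcomp Require Import all_boot all_order all_algebra.
From mathcomp Require Import boolp classical_sets functions cardinality.

Set Implicit Arguments.
Unset Strict Implicit.
Unset Printing Implicit Defensive.

Import Order.TTheory.

Local Open Scope order_scope.
Local Open Scope classical_set_scope.

Definition convex_subset d (L : orderType d) (A : set L) : Prop :=
  forall a, ~ A a -> (forall b, A b -> a < b) \/ (forall b, A b -> b < a).

Definition order_embedding d d' (L : orderType d) (L' : orderType d')
    (f : L -> L') : Prop :=
  {homo f : x y / x < y}.

Definition order_isomorphic d d' (L : orderType d) (L' : orderType d') : Prop :=
  exists f : L -> L', order_embedding f /\ bijective f.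

Definition convex_embeddable d d' (L : orderType d) (L' : orderType d') : Prop :=
  exists f : L -> L', order_embedding f /\ convex_subset (range f).

Definition convex_biembeddable d d' (L : orderType d) (L' : orderType d') : Prop :=
  convex_embeddable L L' /\ convex_embeddable L' L.

(* A set of linear orders is a predicate on the large type [orderType d]; the
   universe of [set] lies strictly below the one of [orderType d], so [set] and
   [countable] cannot be applied to it.  This is [countable] spelled out: see
   [countable_predP]. *)
Definition countable_pred (T : Type) (S : T -> Prop) : Prop :=
  exists f : T -> nat, forall s s', S s -> S s' -> f s = f s' -> s = s'.

Lemma countable_predP (T : Type) (S : set T) : countable_pred S <-> countable S.
Proof.
split=> [[f f_inj]|/countable_injP[f f_inj]].
  apply/countable_injP; exists f => s s' /set_mem Ss /set_mem Ss'.
  exact: f_inj.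
by exists f => s s' Ss Ss'; apply: f_inj; apply/mem_set.
Qed.

(* [S] is a set inside an ambient type [T]; the first conjunct says that [chi]
   takes its values in [S]. *)
Definition dense_coloring d (L : orderType d) (T : Type) (S : T -> Prop)
    (chi : L -> T) : Prop :=
  (forall x, S (chi x)) /\
  (forall s, S s -> forall x x' : L, x < x' ->
     exists y, [/\ x < y, y < x' & chi y = s]).

(* The order on [{x : L & chi x}] is MathComp's lexicographic one: see
   [Order.SigmaOrder.ltEsig], and [sum_lt] below. *)
Definition ordered_sum d d' (L : orderType d) (chi : L -> orderType d') :
    orderType d' :=
  {x : L & chi x}.

Lemma sum_lt d d' (L : orderType d) (chi : L -> orderType d')
    (p p' : ordered_sum chi) :
  p < p' <->
  tag p < tag p' \/
  exists e : tag p = tag p', ecast x (chi x) e (tagged p) < tagged p'.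
Proof.
case: p p' => [x y] [x' y']; rewrite /= Order.SigmaOrder.ltEsig /=.
case: (ltgtP x x') => [lt_xx'|lt_x'x|eq_xx'] /=.
- by split=> // _; left.
- by split=> // -[//|[e _]]; rewrite e ltxx in lt_x'x.
case: x' / eq_xx' y' => y'; rewrite tagged_asE; split=> [lt_yy'|].
  by right; exists erefl.
by case=> [//|[e]]; rewrite (eq_irrelevance e erefl).
Qed.

(* "L is isomorphic to the shuffle of S".  The shuffle is only defined up to
   isomorphism, through an arbitrary dense coloring of the rationals by S;
   the shuffle of the empty set is the empty order. *)
Definition isomorphic_to_shuffle d d' (L : orderType d)
    (S : orderType d' -> Prop) : Prop :=
  ((forall X, ~ S X) /\ (L -> False)) \/
  (exists chi : rat -> orderType d',
     dense_coloring S chi /\ order_isomorphic L (ordered_sum chi)).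

(* Main.v *)
(* Call two points of a linear order far apart if the interval between them
   contains a convex copy of L+.  A shuffle is isomorphic to its part lying over
   any rational interval, so a cut of L+ leaves a copy of L+ on one of its sides,
   and "not far apart" is an equivalence relation with convex classes.  In L+ and
   in L- there is no first or last class, and between two classes lies a convex
   copy of both L+ and L-, hence a class of every isomorphism type occurring in
   either of them.  So L+ and L- are dense sums of the same types of classes, and
   a back-and-forth argument on the classes gives the isomorphism.  The relation
   is intrinsic, whereas the given components need not correspond: a component
   may itself contain a copy of the whole order. *)
Require Import Defs.
From mathcomp Require Import all_boot all_order all_algebra.
From mathcomp Require Import boolp classical_sets functions cardinality.

Set Implicit Arguments.
Unset Strict Implicit.
Unset Printing Implicit Defensive.

Import Order.TTheory GRing.Theory Num.Theory.
Local Open Scope order_scope.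
Local Open Scope classical_set_scope.

(** * Back-and-forth between subsets of two countable orders *)

Lemma seq_maximum (T : eqType) (r : rel T) (s : seq T) :
  reflexive r -> total r -> transitive r -> s <> [::] ->
  exists2 m, m \in s & {in s, forall x, r x m}.
Proof.
move=> r_refl r_tot r_trans; elim: s => [//|x s IHs] _.
have [->|/eqP s_neq0] := eqVneq s [::].
  by exists x; rewrite ?mem_head// => y; rewrite inE => /eqP->.
have [m ms m_max] := IHs s_neq0.
case/orP: (r_tot x m) => [xm|mx].
  by exists m; rewrite ?inE ?ms ?orbT// => y; rewrite inE => /predU1P[->|/m_max].
exists x; rewrite ?mem_head// => y; rewrite inE => /predU1P[->//|/m_max ym].
exact: r_trans ym mx.
Qed.

(** One half of a back-and-forth hypothesis; the other half is the same notion with [P] and [Q]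
    exchanged. The sets [A] and [B] let it apply to rational intervals and to class representatives
    without subtypes. *)
Definition richly_related d d' (P : orderType d) (Q : orderType d')
    (R : P -> Q -> Prop) (A : set P) (B : set Q) : Prop :=
  [/\ exists q, B q,
      forall q, B q -> exists2 q', B q' & q' < q,
      forall q, B q -> exists2 q', B q' & q < q' &
      forall p q1 q2, A p -> B q1 -> B q2 -> q1 < q2 ->
        exists q, [/\ B q, q1 < q, q < q2 & R p q]].

(** Only the maximum of [lo] and the minimum of [hi] matter. When one of the lists is empty, the
    absence of end points in [B] supplies the missing bound. *)
Lemma richly_related_seq d d' (P : orderType d) (Q : orderType d')
    (R : P -> Q -> Prop) (A : set P) (B : set Q) (p : P) (lo hi : seq Q) :
  richly_related R A B -> A p ->
  {in lo, forall q, B q} -> {in hi, forall q, B q} ->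
  {in lo & hi, forall q q', q < q'} ->
  exists q, [/\ B q, R p q, {in lo, forall q', q' < q} &
                {in hi, forall q', q < q'}].
Proof.
move=> [[q0 Bq0] no_min no_max R_dense] Ap loB hiB lo_hi.
have [l [h [Bl Bh lh lo_l hi_h]]] : exists l h,
    [/\ B l, B h, l < h, {in lo, forall q, q <= l} & {in hi, forall q, h <= q}].
  have max_lo := @seq_maximum _ (fun x y : Q => x <= y) lo lexx le_total le_trans.
  have min_hi := @seq_maximum _ (fun x y : Q => y <= x) hi lexx ge_total ge_trans.
  have [lo0|/eqP/max_lo[l l_lo l_max]] := eqVneq lo [::];
    have [hi0|/eqP/min_hi[h h_hi h_min]] := eqVneq hi [::].
  - have [q1 Bq1 q01] := no_max _ Bq0.
    by exists q0, q1; split=> // q; rewrite ?lo0 ?hi0.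
  - have [l Bl lh] := no_min _ (hiB _ h_hi).
    by exists l, h; split=> //; [exact: hiB|rewrite lo0].
  - have [h Bh lh] := no_max _ (loB _ l_lo).
    by exists l, h; split=> //; [exact: loB|rewrite hi0].
  by exists l, h; split=> //; [exact: loB|exact: hiB|exact: lo_hi].
have [q [Bq lq qh Rpq]] := R_dense p l h Ap Bl Bh lh.
exists q; split=> // q' q'_in; first exact: le_lt_trans (lo_l _ q'_in) lq.
exact: lt_le_trans qh (hi_h _ q'_in).
Qed.

Definition partial_iso d d' (P : orderType d) (Q : orderType d')
    (R : P -> Q -> Prop) (A : set P) (B : set Q) (s : seq (P * Q)) : Prop :=
  {in s, forall x, [/\ A x.1, B x.2 & R x.1 x.2]} /\
  {in s &, forall x y, (x.1 < y.1) = (x.2 < y.2)}.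

Lemma partial_iso_forth d d' (P : orderType d) (Q : orderType d')
    (R : P -> Q -> Prop) (A : set P) (B : set Q) (s : seq (P * Q)) (p : P) :
  richly_related R A B -> partial_iso R A B s -> A p ->
  exists s', [/\ partial_iso R A B s', {subset s <= s'} &
                 exists q, (p, q) \in s'].
Proof.
move=> rich [sABR s_mono] Ap.
have [/mapP[[p' q] xs ->]|p_s] := boolP (p \in map fst s).
  by exists s; split=> //; exists q.
pose lo := [seq x.2 | x <- s & x.1 < p].
pose hi := [seq x.2 | x <- s & p < x.1].
have [|||q [Bq Rpq lo_q q_hi]] := @richly_related_seq _ _ P Q R A B p lo hi rich Ap.
- by move=> _ /mapP[x + ->]; rewrite mem_filter => /andP[_ /sABR[]].
- by move=> _ /mapP[x + ->]; rewrite mem_filter => /andP[_ /sABR[]].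
- move=> _ _ /mapP[x + ->] /mapP[y + ->].
  rewrite !mem_filter => /andP[xp xs] /andP[py ys].
  by rewrite -s_mono//; apply: lt_trans py.
have cmp x : x \in s -> (x.1 < p) = (x.2 < q) /\ (p < x.1) = (q < x.2).
  move=> xs; case: (ltgtP x.1 p) => [xp|px|eq_xp].
  - have xq : x.2 < q by apply: lo_q; apply: map_f; rewrite mem_filter xp.
    by rewrite xq lt_gtF.
  - have qx : q < x.2 by apply: q_hi; apply: map_f; rewrite mem_filter px.
    by rewrite qx lt_gtF.
  - by case/negP: p_s; rewrite -eq_xp map_f.
exists ((p, q) :: s); split; last by exists q; rewrite mem_head.
  split=> [x|x y]; first by rewrite inE => /predU1P[->|/sABR].
  rewrite !inE => /predU1P[->|xs] /predU1P[->|ys] /=; rewrite ?ltxx//.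
  - by have [] := cmp y ys.
  - by have [] := cmp x xs.
  - exact: s_mono.
by move=> x xs; rewrite inE xs orbT.
Qed.

Lemma partial_iso_swap d d' (P : orderType d) (Q : orderType d')
    (R : P -> Q -> Prop) (A : set P) (B : set Q) (s : seq (P * Q)) :
  partial_iso R A B s ->
  partial_iso (fun q p => R p q) B A [seq (x.2, x.1) | x <- s].
Proof.
move=> [sABR s_mono]; split=> [_ /mapP[x xs ->]|_ _ /mapP[x xs ->] /mapP[y ys ->]].
  by have [] := sABR _ xs.
by rewrite /= s_mono.
Qed.

Lemma partial_iso_back d d' (P : orderType d) (Q : orderType d')
    (R : P -> Q -> Prop) (A : set P) (B : set Q) (s : seq (P * Q)) (q : Q) :
  richly_related (fun q p => R p q) B A -> partial_iso R A B s -> B q ->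
  exists s', [/\ partial_iso R A B s', {subset s <= s'} &
                 exists p, (p, q) \in s'].
Proof.
move=> rich /partial_iso_swap s_iso Bq.
have [s' [s'_iso ss' [p ps']]] := partial_iso_forth rich s_iso Bq.
exists [seq (x.2, x.1) | x <- s']; split.
- exact: (partial_iso_swap s'_iso).
- move=> [x y] xs; apply/mapP; exists (y, x) => //; apply: ss'.
  by apply/mapP; exists (x, y).
- by exists p; apply/mapP; exists (q, p).
Qed.

(** The assumption on [s] sits under the existential quantifier, so that choice turns the lemma into
    a total function on all finite lists. By injectivity of the codes, at most one point on each
    side has code [n]. *)
Lemma partial_iso_step d d' (P : orderType d) (Q : orderType d')
    (R : P -> Q -> Prop) (A : set P) (B : set Q) (f : P -> nat) (f' : Q -> nat)
    (n : nat) (s : seq (P * Q)) :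
  injective f -> injective f' ->
  richly_related R A B -> richly_related (fun q p => R p q) B A ->
  exists s', partial_iso R A B s ->
    [/\ partial_iso R A B s', {subset s <= s'},
        forall p, A p -> f p = n -> exists q, (p, q) \in s' &
        forall q, B q -> f' q = n -> exists p, (p, q) \in s'].
Proof.
move=> f_inj f'_inj rich rich'.
have [s_iso|not_iso] := pselect (partial_iso R A B s); last by exists s.
have [s1 [s1_iso ss1 dom]] : exists s1, [/\ partial_iso R A B s1,
    {subset s <= s1} & forall p, A p -> f p = n -> exists q, (p, q) \in s1].
  have [[p Ap fp]|nop] := pselect (exists2 p, A p & f p = n).
    have [s1 [s1_iso ss1 ps1]] := partial_iso_forth rich s_iso Ap.
    by exists s1; split=> // p' Ap' fp'; rewrite (f_inj p' p)// fp'.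
  by exists s; split=> // p Ap fp; case: nop; exists p.
have [[q Bq fq]|noq] := pselect (exists2 q, B q & f' q = n).
  have [s2 [s2_iso ss2 qs2]] := partial_iso_back rich' s1_iso Bq.
  exists s2 => _; split=> //.
  - by move=> x /ss1/ss2.
  - by move=> p Ap fp; have [q' /ss2] := dom p Ap fp; exists q'.
  - by move=> q' Bq' fq'; rewrite (f'_inj q' q)// fq'.
by exists s1 => _; split=> // q Bq fq; case: noq; exists q.
Qed.

Lemma countable_setT_inj (T : choiceType) :
  countable [set: T] -> exists f : T -> nat, injective f.
Proof.
move=> /countable_injP[f f_inj]; exists f => x y; apply: f_inj; exact: mem_set.
Qed.

Theorem back_and_forth d d' (P : orderType d) (Q : orderType d')
    (R : P -> Q -> Prop) (A : set P) (B : set Q) :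
  countable [set: P] -> countable [set: Q] ->
  richly_related R A B -> richly_related (fun q p => R p q) B A ->
  exists g : P -> Q,
    [/\ forall p, A p -> B (g p) /\ R p (g p),
        forall p p', A p -> A p' -> p < p' -> g p < g p' &
        forall q, B q -> exists2 p, A p & g p = q].
Proof.
move=> /countable_setT_inj[f f_inj] /countable_setT_inj[f' f'_inj] rich rich'.
have /choice[step stepP] : forall ns : nat * seq (P * Q), exists s', _ :=
  fun ns => partial_iso_step ns.1 ns.2 f_inj f'_inj rich rich'.
(* Stage [n] handles the points of code [n], so a point of code [n] is matched from [S n.+1] on. *)
pose S := fix S n := if n is m.+1 then step (m, S m) else [::].
have S_iso n : partial_iso R A B (S n).
  by elim: n => [|n IHn]; [split|have [] := stepP (n, S n) IHn].
have S_sub m n : (m <= n)%N -> {subset S m <= S n}.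
  move=> /subnK <-; elim: (n - m)%N => [//|k IHk] x /IHk.
  by have [_ sub _ _] := stepP ((k + m)%N, S (k + m)%N) (S_iso _) => /sub.
have S_mono x y m n : x \in S m -> y \in S n -> (x.1 < y.1) = (x.2 < y.2).
  move=> xm yn; have [_ mono] := S_iso (maxn m n).
  by apply: mono; [apply: S_sub xm|apply: S_sub yn]; rewrite ?leq_maxl ?leq_maxr.
have [[q0 _] _ _ _] := rich.
(* Outside [A] the value of [g] is the arbitrary point [q0]. *)
have /choice[g gP] : forall p, exists q, A p -> exists n, (p, q) \in S n.
  move=> p; have [Ap|] := pselect (A p); last by exists q0.
  have [_ _ dom _] := stepP (f p, S (f p)) (S_iso _).
  by have [q pq] := dom p Ap erefl; exists q => _; exists (f p).+1.
exists g; split.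
- move=> p Ap; have [n pn] := gP p Ap.
  by have [SABR _] := S_iso n; have [] := SABR _ pn.
- move=> p p' Ap Ap'; have [n pn] := gP p Ap; have [n' pn'] := gP p' Ap'.
  by rewrite (S_mono _ _ _ _ pn pn').
- move=> q Bq; have [_ _ _ cod] := stepP (f' q, S (f' q)) (S_iso _).
  have [p pq] := cod q Bq erefl.
  have pq' : (p, q) \in S (f' q).+1 by [].
  have [SABR _] := S_iso (f' q).+1; have [/= Ap _ _] := SABR _ pq'.
  exists p => //; have [n pn] := gP p Ap.
  (* Both [(p, g p)] and [(p, q)] occur in the chain; comparing them in both orders rules out
     [g p < q] and [q < g p]. *)
  have := S_mono _ _ _ _ pn pq'; have := S_mono _ _ _ _ pq' pn.
  by rewrite /= !ltxx; case: ltgtP.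
Qed.

(** * Isomorphisms between subsets, and gluing them along fibers *)

(** The map is total on [L] but constrained only on [A]. Since [L] is linear, strict monotonicity
    there includes injectivity and reflection of the order. *)
Definition iso_on d d' (L : orderType d) (M : orderType d')
    (A : set L) (B : set M) : Prop :=
  exists h : L -> M,
    [/\ forall x, A x -> B (h x),
        forall x y, A x -> A y -> x < y -> h x < h y &
        forall z, B z -> exists2 x, A x & h x = z].

Lemma iso_on_sym d d' (L : orderType d) (M : orderType d')
    (A : set L) (B : set M) : inhabited L -> iso_on A B -> iso_on B A.
Proof.
move=> [x0] [h [hB h_mono h_surj]].
(* The inverse takes the default value [x0] outside [B]. *)
have /choice[k kP] : forall z, exists x, B z -> A x /\ h x = z.
  move=> z; have [/h_surj[x]|] := pselect (B z); first by exists x.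
  by exists x0.
exists k; split.
- by move=> z /kP[].
- move=> y z By Bz yz; have [Aky hky] := kP y By; have [Akz hkz] := kP z Bz.
  case: (ltgtP (k y) (k z)) => // [zy|eq_yz].
    by have := h_mono _ _ Akz Aky zy; rewrite hky hkz lt_gtF.
  by move: yz; rewrite -hky -hkz eq_yz ltxx.
- move=> x Ax; exists (h x); first exact: hB.
  have [Akx hkx] := kP _ (hB _ Ax).
  case: (ltgtP (k (h x)) x) => // lt_x.
    by have := h_mono _ _ Akx Ax lt_x; rewrite hkx ltxx.
  by have := h_mono _ _ Ax Akx lt_x; rewrite hkx ltxx.
Qed.

(** [F] acts on each fiber by a chosen isomorphism, and points of different fibers are ordered
    through [g]. Surjectivity is claimed fiber by fiber because [g] may miss part of [J]. The index
    map is [tag] for sums and [rep] for classes. *)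
Lemma glue_fibers d1 d2 d3 d4 (L : orderType d1) (I : orderType d2)
    (M : orderType d3) (J : orderType d4)
    (A : set I) (c : L -> I) (c' : M -> J) (g : I -> J) :
  inhabited L -> {homo c : x y / x <= y} -> {homo c' : x y / x <= y} ->
  (forall x, A (c x)) -> (forall i j, A i -> A j -> i < j -> g i < g j) ->
  (forall i, A i -> iso_on [set x | c x = i] [set z | c' z = g i]) ->
  exists F : L -> M, [/\ order_embedding F, forall x, c' (F x) = g (c x) &
    forall z i, A i -> c' z = g i -> exists x, F x = z].
Proof.
move=> [x0] c_mono c'_mono Ac g_mono fib.
have [h0 _] := fib _ (Ac x0).
have /choice[h hP] : forall i, exists h : L -> M, A i ->
    [/\ forall x, c x = i -> c' (h x) = g i,
        forall x y, c x = i -> c y = i -> x < y -> h x < h y &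
        forall z, c' z = g i -> exists2 x, c x = i & h x = z].
  by move=> i; have [/fib[h]|] := pselect (A i); [exists h|exists h0].
have cF x : c' (h (c x) x) = g (c x).
  by have [cP _ _] := hP _ (Ac x); exact: cP.
exists (fun x => h (c x) x); split=> // [x y xy|z i Ai c'z].
  case: (ltgtP (c x) (c y)) => [lt_c|gt_c|eq_c].
  - rewrite ltNge; apply/negP => /c'_mono; rewrite !cF leNgt.
    by rewrite g_mono.
  - by have := c_mono _ _ (ltW xy); rewrite leNgt gt_c.
  - by have [_ mono _] := hP _ (Ac y); rewrite eq_c; apply: mono.
have [_ _ surj] := hP _ Ai.
by have [x cx hx] := surj _ c'z; exists x; rewrite cx.
Qed.

(** * Self-similarity of shuffles *)

(* [c] stands for the map sending a point of a shuffle to its rational index. *)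
Definition self_similar d (L : orderType d) (c : L -> rat) : Prop :=
  {homo c : x y / x <= y} /\
  forall a b : rat, a < b -> exists f : L -> L,
    [/\ order_embedding f, convex_subset (range f) &
        forall x, a < c (f x) /\ c (f x) < b].

Lemma ltTagged d d' (L : orderType d) (chi : L -> orderType d') (i : L)
    (y y' : chi i) :
  ((Tagged chi y : ordered_sum chi) < Tagged chi y') = (y < y').
Proof. by rewrite Order.SigmaOrder.ltEsig /= lexx tagged_asE. Qed.

Lemma le_tag d d' (L : orderType d) (chi : L -> orderType d') :
  {homo (fun p : ordered_sum chi => tag p) : p p' / p <= p'}.
Proof. by move=> p p'; rewrite Order.SigmaOrder.leEsig => /andP[]. Qed.

Lemma iso_on_eq_color d d' (L : orderType d) (chi : L -> orderType d') (i j : L) :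
  chi i = chi j ->
  iso_on [set p : ordered_sum chi | tag p = i] [set p : ordered_sum chi | tag p = j].
Proof.
move=> e.
have [t [t_mono t_surj]] : exists t : chi i -> chi j,
    {homo t : x y / x < y} /\ forall z, exists x, t x = z.
  (* [e] is an equality of orders; eliminating it makes the transport between the two components the
     identity. *)
  by case: _ / e; exists id; split=> // z; exists z.
(* Choice replaces a dependent match on the index; points outside the fiber of [i] are sent to
   themselves. *)
have /choice[h hP] : forall p : ordered_sum chi, exists p' : ordered_sum chi,
    forall y : chi i, p = Tagged chi y -> p' = Tagged chi (t y).
  move=> [k y0]; have [ki|ki] := eqVneq k i.
    case: _ / (esym ki) y0 => y0; exists (Tagged chi (t y0)) => y /eqP.
    by rewrite eq_Tagged /= => /eqP->.
  by exists (Tagged chi y0) => y /(congr1 tag) /= /eqP; rewrite (negPf ki).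
have hE (y : chi i) : h (Tagged chi y) = Tagged chi (t y) by apply: hP.
have tagE (k : L) (p : ordered_sum chi) : tag p = k -> exists y : chi k, p = Tagged chi y.
  by case: p => k' y /= <-; exists y.
exists h; split=> /=.
- by move=> _ /tagE[y ->]; rewrite hE.
- move=> _ _ /tagE[y ->] /tagE[y' ->]; rewrite !hE !ltTagged; exact: t_mono.
- move=> _ /tagE[z ->]; have [y <-] := t_surj z.
  by exists (Tagged chi y).
Qed.

Lemma rich_interval (T : Type) (S : T -> Prop) (chi : rat -> T) (a b : rat) :
  dense_coloring S chi -> a < b ->
  richly_related (fun i j => chi i = chi j) [set: rat] [set q | a < q < b].
Proof.
move=> [Schi dense] ab.
(* Density of the rationals is read off the coloring, applied to the color of 0. *)
have mid (x y : rat) : x < y -> exists2 z, x < z & z < y.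
  by move=> /(dense _ (Schi 0%R))[z [xz zy _]]; exists z.
split.
- by have [q aq qb] := mid _ _ ab; exists q; rewrite /= aq.
- move=> q /= /andP[aq qb]; have [q' aq' q'q] := mid _ _ aq.
  by exists q' => //=; rewrite aq' (lt_trans q'q).
- move=> q /= /andP[aq qb]; have [q' qq' q'b] := mid _ _ qb.
  by exists q' => //=; rewrite q'b (lt_trans aq).
- move=> p q1 q2 _ /= /andP[aq1 q1b] /andP[aq2 q2b] q12.
  have [q [q1q qq2 e]] := dense _ (Schi p) _ _ q12.
  by exists q; split=> //=; rewrite (lt_trans aq1 q1q) (lt_trans qq2 q2b).
Qed.

Lemma rich_rat (T : Type) (S : T -> Prop) (chi : rat -> T) (B : set rat) :
  dense_coloring S chi ->
  richly_related (fun j i => chi i = chi j) B [set: rat].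
Proof.
move=> [Schi dense]; split=> [|q _|q _|p q1 q2 _ _ _ q12].
- by exists 0%R.
- by exists (q - 1)%R => //; rewrite ltrBlDr ltrDl.
- by exists (q + 1)%R => //; rewrite ltrDl.
- by have [q [q1q qq2 e]] := dense _ (Schi p) _ _ q12; exists q.
Qed.

(** Back-and-forth gives a color-preserving isomorphism from the rationals onto the interval between
    [a] and [b]. Gluing identities of equal components over it yields an embedding whose image is
    exactly the part of the sum over that interval, hence convex. *)
Lemma sum_self_similar d (S : orderType d -> Prop) (chi : rat -> orderType d) :
  dense_coloring S chi -> inhabited (ordered_sum chi) ->
  self_similar (fun p : ordered_sum chi => tag p).
Proof.
move=> dens inh; split; first exact: le_tag.
move=> a b ab.
have rat_cnt : countable [set: rat] := countableP _.
have [g [gAB g_mono g_surj]] := back_and_forth rat_cnt rat_cnt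
  (rich_interval dens ab) (rich_rat [set q | a < q < b] dens).
have fib i : [set: rat] i -> iso_on [set p : ordered_sum chi | tag p = i]
    [set p : ordered_sum chi | tag p = g i].
  by move=> Ti; have [_ e] := gAB i Ti; exact: iso_on_eq_color.
have [F [F_emb tagF F_surj]] :=
  glue_fibers inh (@le_tag _ _ _ chi) (@le_tag _ _ _ chi) (fun=> I) g_mono fib.
have tagF_ab x : a < tag (F x) < b by rewrite tagF; have [] := gAB (tag x) I.
exists F; split=> // [z Fz|x]; last exact/andP.
have [az|za] := ltP a (tag z); last first.
  left=> _ [x _ <-]; rewrite ltNge; apply/negP => /le_tag.
  rewrite leNgt (le_lt_trans za)//; by case/andP: (tagF_ab x).
have [zb|bz] := ltP (tag z) b; last first.
  right=> _ [x _ <-]; rewrite ltNge; apply/negP => /le_tag.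
  rewrite leNgt (lt_le_trans _ bz)//; by case/andP: (tagF_ab x).
have [|i _ gi] := g_surj (tag z); first by rewrite /= az.
by have [x Fx] := F_surj z i I (esym gi); case: Fz; exists x.
Qed.

Lemma convex_comp d1 d2 d3 (A : orderType d1) (B : orderType d2)
    (C : orderType d3) (f : A -> B) (g : B -> C) :
  order_embedding f -> convex_subset (range f) ->
  order_embedding g -> convex_subset (range g) ->
  order_embedding (g \o f) /\ convex_subset (range (g \o f)).
Proof.
move=> f_emb f_cvx g_emb g_cvx; split=> [x y xy|c gfc].
  by apply: g_emb; apply: f_emb.
have [[b _ gb]|/g_cvx] := pselect (range g c).
  have /f_cvx[bf|fb] : ~ range f b.
    by move=> [a _ fa]; apply: gfc; exists a => //=; rewrite fa.
  - by left=> _ [a _ <-]; rewrite -gb; apply: g_emb; apply: bf; exists a.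
  - by right=> _ [a _ <-]; rewrite -gb; apply: g_emb; apply: fb; exists a.
case=> [cg|gc].
- by left=> _ [a _ <-]; apply: cg; exists (f a).
- by right=> _ [a _ <-]; apply: gc; exists (f a).
Qed.

Lemma embedding_lt d d' (L : orderType d) (M : orderType d') (f : L -> M) :
  order_embedding f -> {mono f : x y / x < y}.
Proof.
move=> f_emb x y; case: (ltgtP x y) => [/f_emb->//|/f_emb/lt_gtF->//|->].
exact: ltxx.
Qed.

Lemma surjective_convex d d' (L : orderType d) (M : orderType d') (f : L -> M) :
  (forall z, exists x, f x = z) -> convex_subset (range f).
Proof. by move=> f_surj z []; have [x] := f_surj z; exists x. Qed.

(** The embeddings of the sum are conjugated by the isomorphism [u] and its inverse [v]. *)
Lemma shuffle_self_similar d d' (L : orderType d) (S : orderType d' -> Prop) :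
  inhabited L -> isomorphic_to_shuffle L S -> exists c : L -> rat, self_similar c.
Proof.
move=> [x0] [[_ /(_ x0)//]|[chi [dens [u [u_emb [v uv vu]]]]]].
have [tag_mono sim] := sum_self_similar dens (inhabits (u x0)).
have v_emb : order_embedding v.
  by move=> p q pq; rewrite -(embedding_lt u_emb) !vu.
exists (fun x => tag (u x)); split=> [x y xy|a b /sim[f [f_emb f_cvx f_ab]]].
  by apply: tag_mono; rewrite leNgt (embedding_lt u_emb) -leNgt.
have u_cvx : convex_subset (range u) by apply: surjective_convex => p; exists (v p).
have v_cvx : convex_subset (range v) by apply: surjective_convex => x; exists (u x).
have [fu_emb fu_cvx] := convex_comp u_emb u_cvx f_emb f_cvx.
have [vfu_emb vfu_cvx] := convex_comp fu_emb fu_cvx v_emb v_cvx.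
by exists (v \o (f \o u)); split=> // x /=; rewrite vu.
Qed.

(** * Convex copies inside intervals, and nearness *)

Definition has_copy d d' (K : orderType d) (N : orderType d') (x y : N) : Prop :=
  exists f : K -> N, [/\ order_embedding f, convex_subset (range f) &
    forall z, x <= f z /\ f z <= y].

Definition near d d' (K : orderType d) (N : orderType d') (x y : N) : Prop :=
  ~ has_copy K x y /\ ~ has_copy K y x.

Lemma has_copyW d d' (K : orderType d) (N : orderType d') (x x' y y' : N) :
  x' <= x -> y <= y' -> has_copy K x y -> has_copy K x' y'.
Proof.
move=> x'x yy' [f [f_emb f_cvx f_xy]]; exists f; split=> // z.
by have [xz zy] := f_xy z; rewrite (le_trans x'x xz) (le_trans zy yy').
Qed.

Lemma has_copy_embeddable d d1 d' (K : orderType d) (K' : orderType d1)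
    (N : orderType d') (x y : N) :
  convex_embeddable K K' -> has_copy K' x y -> has_copy K x y.
Proof.
move=> [e [e_emb e_cvx]] [f [f_emb f_cvx f_xy]].
have [fe_emb fe_cvx] := convex_comp e_emb e_cvx f_emb f_cvx.
by exists (f \o e); split=> // z; apply: f_xy.
Qed.

(** A copy between [f x] and [f y] lies inside the convex set [range f], so it pulls back along [f].
    Hence nearness is preserved and reflected by convex embeddings. *)
Lemma has_copy_image d d1 d2 (K : orderType d) (M : orderType d1)
    (N : orderType d2) (f : M -> N) (x y : M) :
  order_embedding f -> convex_subset (range f) ->
  has_copy K (f x) (f y) <-> has_copy K x y.
Proof.
move=> f_emb f_cvx; have f_le z t : (f z <= f t) = (z <= t).
  by rewrite !leNgt (embedding_lt f_emb).
split=> [[h [h_emb h_cvx h_xy]]|[h [h_emb h_cvx h_xy]]]; last first.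
  have [fh_emb fh_cvx] := convex_comp h_emb h_cvx f_emb f_cvx.
  by exists (f \o h); split=> // z /=; rewrite !f_le.
have /choice[k kP] : forall z, exists t, f t = h z.
  move=> z; have [xz zy] := h_xy z; apply: contrapT => nfz.
  have /f_cvx[lt_f|gt_f] : ~ range f (h z) by move=> [t _ e]; apply: nfz; exists t.
  - by have := lt_f (f x); rewrite ltNge xz => /(_ (ex_intro2 _ _ x I erefl)).
  - by have := gt_f (f y); rewrite ltNge zy => /(_ (ex_intro2 _ _ y I erefl)).
exists k; split=> [z t zt|m km|z].
- by rewrite -(embedding_lt f_emb) !kP; exact: h_emb.
- have /h_cvx[lt_h|gt_h] : ~ range h (f m).
    move=> [z _ e]; apply: km; exists z => //.
    by apply: le_anti; rewrite -!f_le kP e lexx.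
  + by left=> _ [z _ <-]; rewrite -(embedding_lt f_emb) kP; apply: lt_h; exists z.
  + by right=> _ [z _ <-]; rewrite -(embedding_lt f_emb) kP; apply: gt_h; exists z.
- by rewrite -!f_le kP.
Qed.

(** * Nearness as a convex equivalence relation, and its representatives *)

Section Condensation.
Context d (K : orderType d) (cK : K -> rat) (k0 : K).
Hypothesis K_sim : self_similar cK.

Lemma self_similar_has_copyl (x : K) : exists y, has_copy K y x.
Proof.
have [cK_mono sim] := K_sim.
have [|f [f_emb f_cvx f_ab]] := sim (cK x - 1)%R (cK x); first by rewrite ltrBlDr ltrDl.
(* The copy [f] has indices just below that of [x]; this second one only provides a point [h k0]
   below the whole of [f]. *)
have [|h [h_emb h_cvx h_ab]] := sim (cK x - 2)%R (cK x - 1)%R; first by rewrite ltrD2l.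
exists (h k0), f; split=> // z; split; rewrite leNgt; apply/negP => /ltW/cK_mono.
- by rewrite leNgt (lt_trans (h_ab k0).2 (f_ab z).1).
- by rewrite leNgt (f_ab z).2.
Qed.

Lemma self_similar_has_copyr (x : K) : exists y, has_copy K x y.
Proof.
have [cK_mono sim] := K_sim.
have [|f [f_emb f_cvx f_ab]] := sim (cK x) (cK x + 1)%R; first by rewrite ltrDl.
have [|h [h_emb h_cvx h_ab]] := sim (cK x + 1)%R (cK x + 2)%R; first by rewrite ltrD2l.
exists (h k0), f; split=> // z; split; rewrite leNgt; apply/negP => /ltW/cK_mono.
- by rewrite leNgt (f_ab z).1.
- by rewrite leNgt (lt_trans (f_ab z).2 (h_ab k0).1).
Qed.

Context d' (N : orderType d').
Implicit Types x y z : N.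

(* Both the part of [K] below [k0] and the part above it contain a copy of [K]. *)
Lemma has_copy_split x y z : has_copy K x z -> has_copy K x y \/ has_copy K y z.
Proof.
move=> [f [f_emb f_cvx f_xz]].
have [fy|yf] := leP (f k0) y.
- left; have [k /(has_copy_image _ _ _ f_emb f_cvx)] := self_similar_has_copyl k0.
  by apply: has_copyW => //; have [] := f_xz k.
- right; have [k /(has_copy_image _ _ _ f_emb f_cvx)] := self_similar_has_copyr k0.
  by apply: has_copyW; [exact: ltW|have [] := f_xz k].
Qed.

(** Self-similarity gives [K] two distinct points, with indices in (0,1) and (1,2), so no copy of
    [K] fits into a single point. *)
Lemma has_copy_lt x y : has_copy K x y -> x < y.
Proof.
have [cK_mono sim] := K_sim.
have [//|f [_ _ f_ab]] := sim 0%R 1%R.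
have [//|h [_ _ h_ab]] := sim 1%R 2%R.
have fh : f k0 < h k0.
  rewrite ltNge; apply/negP => /cK_mono.
  by rewrite leNgt (lt_trans (f_ab k0).2 (h_ab k0).1).
move=> [g [g_emb _ g_xy]].
exact: le_lt_trans (g_xy (f k0)).1 (lt_le_trans (g_emb _ _ fh) (g_xy (h k0)).2).
Qed.

Lemma near_refl x : near K x x.
Proof. by split=> /has_copy_lt; rewrite ltxx. Qed.

Lemma near_sym x y : near K x y -> near K y x.
Proof. by case. Qed.

Lemma near_trans x y z : near K x y -> near K y z -> near K x z.
Proof. by move=> [xy yx] [yz zy]; split=> /(has_copy_split y)[]. Qed.

Lemma not_near_lt x y : x < y -> ~ near K x y -> has_copy K x y.
Proof.
by move=> xy /not_andP[/contrapT//|/contrapT/has_copy_lt]; rewrite lt_gtF.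
Qed.

(** Classes are coded by canonical points of [N] instead of a quotient, so they inherit the order of
    [N]. [choose] depends only on the predicate, hence only on the class. *)
Definition rep x : N := choose (fun y => `[< near K x y >]) x.

Lemma near_rep x : near K x (rep x).
Proof.
apply/asboolP; apply: (@chooseP _ (fun y => `[< near K x y >])).
by apply/asboolP; exact: near_refl.
Qed.

Lemma rep_eq x y : near K x y <-> rep x = rep y.
Proof.
split=> [xy|e].
  rewrite /rep -(@eq_choose _ (fun z => `[< near K x z >])) => [|z].
    by apply: choose_id; apply/asboolP => //; exact: near_refl.
  apply: asbool_equiv_eq; split=> [xz|]; last exact: near_trans.
  by apply: near_trans xz; exact: near_sym.
apply: near_trans (near_rep x) _; rewrite e; exact: near_sym (near_rep y).
Qed.

Lemma rep_id x : rep (rep x) = rep x.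
Proof. by apply/rep_eq/near_sym/near_rep. Qed.

(** Moving an end point to its representative cannot destroy a copy: by [has_copy_split], a copy
    would otherwise lie between two near points. *)
Lemma has_copy_rep x y : has_copy K x y <-> rep x < rep y.
Proof.
have [[xr rx] [yr ry]] := (near_rep x, near_rep y).
split=> [/(has_copy_split (rep x))[//|]|rxy].
  by move=> /(has_copy_split (rep y))[/has_copy_lt|].
have /(has_copy_split x)[//|] : has_copy K (rep x) (rep y).
  by apply: not_near_lt => // /rep_eq e; move: rxy; rewrite -(rep_id x) e rep_id ltxx.
by move=> /(has_copy_split y)[].
Qed.

Lemma rep_le : {homo rep : x y / x <= y}.
Proof.
move=> x y xy; rewrite leNgt; apply/negP => /has_copy_rep/has_copy_lt.
by rewrite ltNge xy.
Qed.

End Condensation.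

(** * Matching the classes of two orders *)

Definition copies_around d d' (K : orderType d) (N : orderType d') : Prop :=
  forall x : N, (exists y, has_copy K y x) /\ (exists y, has_copy K x y).

Lemma self_similar_copies_around d d' (K : orderType d) (N : orderType d')
    (c : N -> rat) :
  self_similar c -> convex_embeddable K N -> copies_around K N.
Proof.
move=> N_sim KN x; split.
- have [y xy] := self_similar_has_copyl x N_sim x.
  by exists y; exact: has_copy_embeddable KN xy.
- have [y xy] := self_similar_has_copyr x N_sim x.
  by exists y; exact: has_copy_embeddable KN xy.
Qed.

Section Classes.
Context d (K : orderType d) (cK : K -> rat) (k0 : K).
Hypothesis K_sim : self_similar cK.

Local Notation rep := (rep K).
Local Notation class p := [set x | rep x = p].

(* The class of [m] lies between two points far from [m], so its image is
   convex and is not cut short at the ends of [range f]. *)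
Lemma iso_on_class_image d1 d2 (M : orderType d1) (N : orderType d2)
    (f : M -> N) (m : M) :
  copies_around K M -> order_embedding f -> convex_subset (range f) ->
  iso_on (class (rep m)) (class (rep (f m))).
Proof.
move=> M_around f_emb f_cvx.
have rep_f x y : rep (f x) = rep (f y) <-> rep x = rep y.
  rewrite -!(rep_eq k0 K_sim).
  by split=> -[xy yx]; split=> /(has_copy_image _ _ _ f_emb f_cvx).
exists f; split=> /= [x|x y _ _|z e]; [by move=> /rep_f|exact: f_emb|].
have [[m' /(has_copy_image _ _ _ f_emb f_cvx)/(has_copy_rep k0 K_sim) m'm]
      [m'' /(has_copy_image _ _ _ f_emb f_cvx)/(has_copy_rep k0 K_sim) mm'']] := M_around m.
have [x fx] : exists x, f x = z.
  apply: contrapT => nfz.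
  have /f_cvx[lt_f|gt_f] : ~ range f z by move=> [t _ ft]; apply: nfz; exists t.
  - have /ltW/(rep_le k0 K_sim) := lt_f _ (ex_intro2 _ _ m' I erefl).
    by rewrite e leNgt m'm.
  - have /ltW/(rep_le k0 K_sim) := gt_f _ (ex_intro2 _ _ m'' I erefl).
    by rewrite e leNgt mm''.
by exists x => //; apply/rep_f; rewrite fx.
Qed.

(** Between two classes lies a convex copy of [K], hence one of [M], which brings along a class
    isomorphic to any prescribed class of [M]. *)
Lemma rich_classes d1 d2 (M : orderType d1) (N : orderType d2) :
  inhabited N -> copies_around K M -> copies_around K N ->
  convex_embeddable M K ->
  richly_related (fun (p : M) (q : N) => iso_on (class p) (class q))
    [set p | rep p = p] [set q | rep q = q].
Proof.
move=> [n0] M_around N_around MK; split.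
- by exists (rep n0); exact: (rep_id k0 K_sim).
- move=> q qq; have [[y /(has_copy_rep k0 K_sim)]] := N_around q.
  by rewrite qq; exists (rep y) => //; exact: (rep_id k0 K_sim).
- move=> q qq; have [_ [y /(has_copy_rep k0 K_sim)]] := N_around q.
  by rewrite qq; exists (rep y) => //; exact: (rep_id k0 K_sim).
- move=> p q1 q2 pp qq1 qq2; rewrite -{1}qq1 -{1}qq2.
  move=> /(has_copy_rep k0 K_sim)/(has_copy_embeddable MK)[f [f_emb f_cvx f_q]].
  (* The points [p1] and [p2], far from [p] on either side, keep the class of [f p] strictly between
     those of [q1] and [q2]. *)
  have [[p1 p1p] [p2 pp2]] := M_around p.
  exists (rep (f p)); split.
  + exact: (rep_id k0 K_sim).
  + rewrite -qq1; apply/(has_copy_rep k0 K_sim).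
    by apply: has_copyW (f_q p1).1 (lexx _) _; apply/(has_copy_image _ _ _ f_emb f_cvx).
  + rewrite -qq2; apply/(has_copy_rep k0 K_sim).
    by apply: has_copyW (lexx _) (f_q p2).2 _; apply/(has_copy_image _ _ _ f_emb f_cvx).
  + by rewrite -{1}pp; exact: iso_on_class_image.
Qed.

Lemma rich_classes_sym d1 d2 (M : orderType d1) (N : orderType d2) :
  inhabited M -> inhabited N -> copies_around K M -> copies_around K N ->
  convex_embeddable N K ->
  richly_related (fun (q : N) (p : M) => iso_on (class p) (class q))
    [set q | rep q = q] [set p | rep p = p].
Proof.
move=> M_inh N_inh M_around N_around NK.
have [ex no_min no_max dense] := rich_classes M_inh N_around M_around NK.
split=> // q p1 p2 Bq Ap1 Ap2 p12.
have [p [Ap p1p pp2 iso]] := dense q p1 p2 Bq Ap1 Ap2 p12.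
by exists p; split=> //; exact: iso_on_sym iso.
Qed.

(** Back-and-forth runs on the representatives, and the resulting [g] is extended to all points by
    gluing along [rep]. *)
Lemma isomorphic_of_classes d1 d2 (M : orderType d1) (N : orderType d2) :
  countable [set: M] -> countable [set: N] ->
  inhabited M -> inhabited N -> copies_around K M -> copies_around K N ->
  convex_embeddable M K -> convex_embeddable N K ->
  order_isomorphic M N.
Proof.
move=> M_cnt N_cnt M_inh N_inh M_around N_around MK NK.
have [g [gAB g_mono g_surj]] := back_and_forth M_cnt N_cnt
  (rich_classes N_inh M_around N_around MK)
  (rich_classes_sym M_inh N_inh M_around N_around NK).
have [F [F_emb _ F_surj]] := glue_fibers M_inh (@rep_le _ _ _ k0 K_sim _ M)
  (@rep_le _ _ _ k0 K_sim _ N) (@rep_id _ _ _ k0 K_sim _ M) g_mono (fun i Ai => (gAB i Ai).2).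
have /choice[G FG] : forall z, exists x, F x = z.
  move=> z; have [i Ai gi] := g_surj (rep z) (rep_id k0 K_sim z).
  exact: F_surj z i Ai (esym gi).
exists F; split=> //; exists G => // x; apply: le_anti.
by rewrite !leNgt -!(embedding_lt F_emb) FG ltxx.
Qed.

End Classes.

Theorem theorem1 (dp dm : Order.disp_t) (Lp : orderType dp) (Lm : orderType dm)
  (hLp : countable [set: Lp]%classic) (hLm : countable [set: Lm]%classic)
  (hbi : convex_biembeddable Lp Lm)
  (hp : exists (d : Order.disp_t) (Sp : orderType d -> Prop),
      countable_pred Sp /\ isomorphic_to_shuffle Lp Sp)
  (hm : exists (d : Order.disp_t) (Sm : orderType d -> Prop),
      countable_pred Sm /\ isomorphic_to_shuffle Lm Sm) :
  order_isomorphic Lp Lm.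
Proof.
have [hpm hmp] := hbi; have [[f [f_emb _]] [f' [f'_emb _]]] := (hpm, hmp).
(* If [Lp] is empty, so is [Lm], because [f'] maps it into [Lp]. *)
have [[x0]|Lp0] := pselect (inhabited Lp); last first.
  have Lp_false (x : Lp) : False := Lp0 (inhabits x).
  by exists f; split=> //; exists f' => x; [case: (Lp_false x)|case: (Lp_false (f' x))].
have [d [Sp [_ /(shuffle_self_similar (inhabits x0))[cp p_sim]]]] := hp.
have [d' [Sm [_ /(shuffle_self_similar (inhabits (f x0)))[cm m_sim]]]] := hm.
have hpp : convex_embeddable Lp Lp.
  by exists id; split=> //; apply: surjective_convex => z; exists z.
(* Nearness is measured by copies of [Lp] in both orders, so [K] is [Lp]. *)
apply: (isomorphic_of_classes x0 p_sim hLp hLm (inhabits x0) (inhabits (f x0))) => //.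
- exact: self_similar_copies_around p_sim hpp.
- exact: self_similar_copies_around m_sim hpm.
Qed.
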